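(* Let $\mathcal{M}$ be a Hadamard manifold and let $F \colon \mathcal{M} \to \overline{\mathbb{R}}$ be a proper (geodesically) convex function. Then, for $p\in\mathcal{M}$ and $\xi\in T_p^*\mathcal{M}$, one has $\xi \in \partial F(p)$ if and only if $F^*(p,\xi) = -F(p)$.
   Context: $\overline{\mathbb{R}} = \mathbb{R} \cup \{\pm\infty\}$, with the convention $-(-\infty)=+\infty$, $-(+\infty)=-\infty$. A Hadamard manifold is a (connected, smooth, finite-dimensional) complete, simply connected Riemannian manifold with nonpositive sectional curvature everywhere; on it, $\exp_p \colon T_p\mathcal{M} \to \mathcal{M}$ is a diffeomorphism for every $p$, with inverse $\log_p \colon \mathcal{M} \to T_p\mathcal{M}$, and any two points are connected by a unique geodesic $\gamma \colon [0,1]\to\mathcal{M}$. $T^*\mathcal{M} = \bigcup_{p}\{p\}\times T_p^*\mathcal{M}$ is the cotangent bundle and $\langle \xi, X\rangle = \xi(X)$ is the duality pairing of $\xi\in T_p^*\mathcal{M}$, $X\in T_p\mathcal{M}$. For $F\colon \mathcal{M}\to\overline{\mathbb{R}}$: $F$ is proper if $\operatorname{dom} F = \{p : F(p)<\infty\}\neq\emptyset$ and $F(p)>-\infty$ for all $p\in\mathcal{M}$. $F$ is convex if for all $p,q\in\mathcal{M}$ the composition of $F$ with the geodesic $[0,1]\to\mathcal{M}$ from $p$ to $q$ is a convex function on $[0,1]$. The subdifferential of a proper convex $F$ at $p\in\mathcal{M}$ is $\partial F(p) = \{\xi\in T_p^*\mathcal{M} : F(q)\ge F(p)+\langle\xi,\log_p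 q\rangle \text{ for all } q\in\mathcal{M}\}$. The Fenchel conjugate of $F$ is $F^*\colon T^*\mathcal{M}\to\overline{\mathbb{R}}$, $F^*(p,\xi) = \sup_{q\in\mathcal{M}}\{\langle \xi,\log_p q\rangle - F(q)\}$. *)

(* Defs.v *)
From HB Require Import structures.
From mathcomp Require Import all_boot all_order all_algebra.
From mathcomp Require Import all_classical all_reals all_analysis.

Set Implicit Arguments.
Unset Strict Implicit.
Unset Printing Implicit Defensive.

Import Order.TTheory GRing.Theory Num.Theory.
Import numFieldNormedType.Exports.

Local Open Scope classical_set_scope.
Local Open Scope ring_scope.

Fixpoint class_C (R : realType) (n : nat) (W : normedModType R) (k : nat)
    (U : set 'rV[R]_n) (f : 'rV[R]_n -> W) : Prop :=
  if k is k'.+1 then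
    (forall x, U x -> differentiable f x) /\
    (forall v, class_C k' U ('D_v f))
  else forall x, U x -> {for x, continuous f}.

(* [U] is meant to be open. *)
Definition smooth_on (R : realType) (n : nat) (W : normedModType R)
    (U : set 'rV[R]_n) (f : 'rV[R]_n -> W) : Prop :=
  forall k, class_C k U f.

(* Path-connected, with every loop null-homotopic relative to its base point. *)
Definition simply_connected (R : realType) (T : topologicalType) : Prop :=
  (forall x y : T, exists c : R -> T,
     [/\ {within `[0, 1], continuous c}, c 0 = x & c 1 = y]) /\
  (forall c : R -> T, {within `[0, 1], continuous c} -> c 0 = c 1 ->
     exists H : R * R -> T,
       [/\ {within `[0, 1] `*` `[0, 1], continuous H},
           forall t, t \in `[0, 1] -> H (0, t) = c t,
           forall t, t \in `[0, 1] -> H (1, t) = c 0 &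
           forall s, s \in `[0, 1] -> H (s, 0) = c 0 /\ H (s, 1) = c 0]).

(* A homeomorphism between an open subset [chart_dom] of [T] and an open subset
   of R^n.  [chart_map] and [chart_inv] are total functions whose values outside
   [chart_dom] and [chart_img] carry no meaning. *)
Record chart (R : realType) (n : nat) (T : topologicalType) := Chart {
  chart_dom : set T;
  chart_map : T -> 'rV[R]_n;
  chart_inv : 'rV[R]_n -> T;
  chart_dom_open : open chart_dom;
  chart_img_open : open (chart_map @` chart_dom);
  chart_mapK : forall x, chart_dom x -> chart_inv (chart_map x) = x;
  chart_map_continuous : {within chart_dom, continuous chart_map};
  chart_inv_continuous :
    {within chart_map @` chart_dom, continuous chart_inv}
}.

Definition chart_img (R : realType) (n : nat) (T : topologicalType)
    (a : chart R n T) : set 'rV[R]_n :=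
  chart_map a @` chart_dom a.

Definition transition (R : realType) (n : nat) (T : topologicalType)
    (a b : chart R n T) : 'rV[R]_n -> 'rV[R]_n :=
  chart_map b \o chart_inv a.

(* Every point comes with a preferred chart [chart_at p], which is used to
   identify the tangent space at [p] with R^n. *)
Record smoothManifold (R : realType) (n : nat) := SmoothManifold {
  carrier :> topologicalType;
  atlas : set (chart R n carrier);
  chart_at : carrier -> chart R n carrier;
  manifold_hausdorff : hausdorff_space carrier;
  manifold_second_countable : @second_countable carrier;
  atlas_smooth : forall a b, atlas a -> atlas b ->
    smooth_on (chart_map a @` (chart_dom a `&` chart_dom b)) (transition a b);
  atlas_chart_at : forall p, atlas (chart_at p);
  chart_at_dom : forall p, chart_dom (chart_at p) p
}.

(* A tangent vector at [p] is its row of coordinates in [chart_at p]; its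
   coordinates in another chart are obtained by applying the Jacobian of the
   transition map. *)
Definition tangent (R : realType) (n : nat) (M : smoothManifold R n) (p : M) :
  Type := 'rV[R]_n.

Definition cotangent (R : realType) (n : nat) (M : smoothManifold R n) (p : M) :
  Type := {scalar 'rV[R]_n}.

Definition pairing (R : realType) (n : nat) (M : smoothManifold R n) (p : M)
    (xi : cotangent p) (X : tangent p) : R :=
  (xi : {scalar 'rV[R]_n}) X.

(* The velocity at time [t] of a curve [c] with [c t = p]. *)
Definition velocity (R : realType) (n : nat) (M : smoothManifold R n)
    (p : M) (c : R -> M) (t : R) : tangent p :=
  'D_1 (chart_map (chart_at p) \o c) t.

(* Gram matrix, in the coordinates of the chart [a] at the point [x] of its
   image, of a field [g] of bilinear forms on the tangent spaces.  The
   directional derivative of [f] along [v] is [v *m 'J f x] (row vectors),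
   whence the side on which the Jacobian is transposed. *)
Definition gram (R : realType) (n : nat) (M : smoothManifold R n)
    (g : M -> 'M[R]_n) (a : chart R n M) (x : 'rV[R]_n) : 'M[R]_n :=
  let p := chart_inv a x in
  let J := jacobian (transition a (chart_at p)) x in
  J *m g p *m J^T.

Definition form (R : realType) (n : nat) (G : 'M[R]_n) (u v : 'rV[R]_n) : R :=
  (u *m G *m v^T) 0 0.

(* [metric p] is the Gram matrix of the inner product on [tangent p]. *)
Record riemannianManifold (R : realType) (n : nat) := RiemannianManifold {
  manifold :> smoothManifold R n;
  metric : manifold -> 'M[R]_n;
  metric_sym : forall p, (metric p)^T = metric p;
  metric_pos : forall p (u : 'rV[R]_n), u != 0 -> 0 < form (metric p) u u;
  metric_smooth : forall a, atlas a -> forall i j,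
    smooth_on (chart_img a) (fun x => gram metric a x i j : R)
}.

Section RiemannianGeometry.
Context (R : realType) (n : nat) (M : riemannianManifold R n).
Implicit Types (a : chart R n M) (x u v w : 'rV[R]_n) (i j k l : 'I_n).

Definition partial (i : 'I_n) (f : 'rV[R]_n -> R) : 'rV[R]_n -> R :=
  'D_(delta_mx 0 i) f.

(* Gamma_{ij}^k of the Levi-Civita connection, in the chart [a]. *)
Definition christoffel a i j k x : R :=
  let g_ i' j' y := gram (@metric R n M) a y i' j' in
  2^-1 * \sum_l invmx (gram (@metric R n M) a x) k l *
    (partial i (g_ j l) x + partial j (g_ i l) x - partial l (g_ i j) x).

(* The l-th component of R(e_i, e_j) e_k, with the sign convention
   R(X, Y) Z = D_X D_Y Z - D_Y D_X Z - D_[X, Y] Z. *)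
Definition riemann a i j k l x : R :=
  partial i (christoffel a j k l) x - partial j (christoffel a i k l) x +
  \sum_m (christoffel a j k m x * christoffel a i m l x -
          christoffel a i k m x * christoffel a j m l x).

Definition curvature a x u v w : 'rV[R]_n :=
  \row_l \sum_i \sum_j \sum_k u 0 i * v 0 j * w 0 k * riemann a i j k l x.

Definition sectional_curvature a x u v : R :=
  let G := form (gram (@metric R n M) a x) in
  G (curvature a x u v v) u / (G u u * G v v - G u v ^+ 2).

Definition nonpositive_curvature : Prop :=
  forall a x u v, atlas a -> chart_img a x -> row_free (col_mx u v) ->
    sectional_curvature a x u v <= 0.

(* The geodesic equation at every time of [I], an open set of parameters. *)
Definition geodesic_on (I : set R) (c : R -> M) : Prop :=
  forall t, I t -> {for t, continuous c} /\
    forall a, atlas a -> chart_dom a (c t) ->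
      let y := chart_map a \o c in
      [/\ derivable y t 1, derivable ('D_1 y) t 1 &
          forall k, ('D_1 ('D_1 y) t) 0 k +
            \sum_i \sum_j christoffel a i j k (y t) *
              ('D_1 y t) 0 i * ('D_1 y t) 0 j = 0].

(* Differentiability on the closed interval [0, 1] is understood as
   differentiability on a neighborhood of it. *)
Definition geodesic_from_to (p q : M) (c : R -> M) : Prop :=
  [/\ (exists2 e : R, 0 < e & geodesic_on `]- e, 1 + e[ c), c 0 = p & c 1 = q].

Definition geodesically_complete : Prop :=
  forall (p : M) (v : tangent p), exists c : R -> M,
    [/\ geodesic_on setT c, c 0 = p & velocity p c 0 = v].

(* exp_p v = q *)
Definition is_exp (p : M) (v : tangent p) (q : M) : Prop :=
  exists2 c : R -> M, geodesic_from_to p q c & velocity p c 0 = v.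

(* [log p] is the inverse of exp_p: the right-hand side is the graph of exp_p.  On
   a Hadamard manifold there is exactly one such [log] (Cartan-Hadamard). *)
Definition is_log (log : forall p : M, M -> tangent p) : Prop :=
  forall (p q : M) (v : tangent p), log p q = v <-> is_exp v q.

Local Open Scope ereal_scope.

Definition proper_function (F : M -> \bar R) : Prop :=
  (exists p, F p < +oo) /\ (forall p, -oo < F p).

(* The endpoints are restricted to the effective domain because the sum
   [+oo + -oo] is [-oo] in [\bar R], whereas the convexity inequality is vacuous
   as soon as one endpoint has value [+oo]. *)
Definition convex_on_unit_interval (f : R -> \bar R) : Prop :=
  forall s r t : R, s \in `[0, 1]%R -> r \in `[0, 1]%R -> t \in `[0, 1]%R ->
    f s < +oo -> f r < +oo ->
    f ((1 - t) * s + t * r)%R <= (1 - t)%:E * f s + t%:E * f r.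

Definition geodesically_convex (F : M -> \bar R) : Prop :=
  forall (p q : M) (c : R -> M), geodesic_from_to p q c ->
    convex_on_unit_interval (F \o c).

Definition subdifferential (log : forall p : M, M -> tangent p)
    (F : M -> \bar R) (p : M) : set (cotangent p) :=
  [set xi | forall q, F p + (pairing xi (log p q))%:E <= F q].

Definition fenchel_conjugate (log : forall p : M, M -> tangent p)
    (F : M -> \bar R) (p : M) (xi : cotangent p) : \bar R :=
  ereal_sup [set (pairing xi (log p q))%:E - F q | q in [set: M]].

End RiemannianGeometry.

Arguments nonpositive_curvature {R n} M.
Arguments geodesically_complete {R n} M.
Arguments subdifferential {R n M} log F p _.
Arguments fenchel_conjugate {R n M} log F p xi.

Record hadamardManifold (R : realType) (n : nat) := HadamardManifold {
  riemannian :> riemannianManifold R n;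
  hadamard_connected : connected [set: riemannian];
  hadamard_complete : geodesically_complete riemannian;
  hadamard_simply_connected : simply_connected R riemannian;
  hadamard_curvature : nonpositive_curvature riemannian
}.

(* Main.v *)
Require Import Defs.
From mathcomp Require Import all_boot all_order all_algebra.
From mathcomp Require Import all_classical all_reals all_analysis.
Set Implicit Arguments.
Unset Strict Implicit.
Unset Printing Implicit Defensive.
Import Order.TTheory GRing.Theory Num.Theory.
Local Open Scope classical_set_scope.
Local Open Scope ring_scope.

(** The subgradient inequality [F p + <xi, log_p q> <= F q] says the same as
    [<xi, log_p q> - F q <= - F p], so [xi] is a subgradient at [p] if and only
    if [- F p] is an upper bound of the set whose supremum is [F^*(p, xi)].  As
    the constant curve at [p] is a geodesic of velocity zero, [log_p p = 0]:
    [- F p] is the element of this set obtained for [q = p].  It is thus an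
    upper bound if and only if it is the supremum. *)

(** Only [x] has to be finite.  For instance, if [a] is [+oo], then both sides
    say that [b] is [+oo]. *)
Lemma leeDfin_sub (R : realType) (a b : \bar R) (x : R) :
  (a + x%:E <= b)%E = (x%:E - b <= - a)%E.
Proof.
case: a => [a| |]; case: b => [b| |] //=; rewrite ?leey ?leNye //.
by rewrite -EFinD -EFinB !lee_fin lerBlDr [in RHS]addrC lerBrDr addrC.
Qed.

Section ConstantGeodesic.
Context (R : realType) (n : nat) (M : riemannianManifold R n).

Lemma geodesic_on_cst (I : set R) (p : M) : geodesic_on I (fun=> p).
Proof.
move=> t _; split; first exact: cvg_cst.
move=> a _ _ y.
have y'0 : 'D_1 y = cst 0 by apply/funext => s; exact: derive_cst.
split; first exact: derivable_cst.
- by rewrite y'0; exact: derivable_cst.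
- move=> k; rewrite y'0 derive_cst mxE add0r.
  rewrite big1 // => i _; rewrite big1 // => j _.
  by rewrite derive_cst !mxE mulr0.
Qed.

Lemma is_exp0 (p : M) : is_exp (0 : tangent p) p.
Proof.
exists (fun=> p); last exact: derive_cst.
by split=> //; exists 1 => //; exact: geodesic_on_cst.
Qed.

Lemma log_refl (log : forall p : M, M -> tangent p) (logP : is_log log)
    (p : M) : log p p = 0.
Proof. by apply/logP; exact: is_exp0. Qed.

End ConstantGeodesic.

Theorem theorem3p13 (R : realType) (n : nat) (M : hadamardManifold R n)
    (log : forall p : M, M -> tangent p) (logP : is_log log)
    (F : M -> \bar R)
    (F_proper : proper_function F) (F_convex : geodesically_convex F)
    (p : M) (xi : cotangent p) :
  subdifferential log F p xi <-> fenchel_conjugate log F p xi = (- F p)%E.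
Proof.
rewrite /subdifferential /fenchel_conjugate /=; split=> [sub|conj q].
- apply/eqP; rewrite eq_le; apply/andP; split.
  + by apply: ge_ereal_sup => _ [q _ <-]; rewrite -leeDfin_sub.
  + apply: ereal_sup_ubound; exists p => //.
    by rewrite (log_refl logP) /pairing linear0 add0e.
- by rewrite leeDfin_sub -conj; apply: ereal_sup_ubound; exists q.
Qed.
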